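(* Let $\overline F\colon\mathbf{PMet}\to\mathbf{PMet}$ be a lifting of a functor $F\colon\mathbf{Set}\to\mathbf{Set}$ which has a final coalgebra $\kappa\colon\Omega\to F\Omega$. For every ordinal $i$ define a pseudometric $d_i$ on $\Omega$ by: $d_0$ the constant zero pseudometric, $d_{i+1}:=d_i^F\circ(\kappa\times\kappa)$, and $d_j:=\sup_{i<j}d_i$ for limit ordinals $j$. Then this sequence converges at some ordinal $\theta$, i.e. $d_\theta=d_\theta^F\circ(\kappa\times\kappa)$, and $\kappa\colon(\Omega,d_\theta)\to(F\Omega,d_\theta^F)$ is a final $\overline F$-coalgebra.
   Context: Fix $\top\in(0,\infty]$. A pseudometric on $X$ is $d\colon X\times X\to[0,\top]$ with $d(x,x)=0$, symmetry and the triangle inequality. $\mathbf{PMet}$ is the category of pseudometric spaces and nonexpansive maps ($d_Y(f(x),f(x'))\le d_X(x,x')$); $U\colon\mathbf{PMet}\to\mathbf{Set}$ is the forgetful functor. A lifting of $F$ is a functor $\overline F\colon\mathbf{PMet}\to\mathbf{PMet}$ with $U\circ\overline F=F\circ U$; for a pseudometric space $(X,d)$, $d^F$ denotes the pseudometric on $FX$ such that $\overline F(X,d)=(FX,d^F)$. An $\overline F$-coalgebra is a nonexpansive map $(X,d)\to\overline F(X,d)$, and a morphism of coalgebras is a nonexpansive map commuting with the structure maps. *)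

(* Defs.v *)
From mathcomp Require Import all_boot all_order all_algebra.
From mathcomp Require Import boolp classical_sets constructive_ereal reals ereal.

Set Implicit Arguments.
Unset Strict Implicit.
Unset Printing Implicit Defensive.

Import Order.TTheory GRing.Theory Num.Theory.

Local Open Scope classical_set_scope.
Local Open Scope ereal_scope.

Record category := Category {
  cat_obj :> Type;
  cat_hom : cat_obj -> cat_obj -> Type;
  cat_id : forall X, cat_hom X X;
  cat_comp : forall X Y Z, cat_hom Y Z -> cat_hom X Y -> cat_hom X Z;
  cat_comp1f : forall X Y (f : cat_hom X Y), cat_comp (cat_id Y) f = f;
  cat_compf1 : forall X Y (f : cat_hom X Y), cat_comp f (cat_id X) = f;
  cat_compA : forall X Y Z W (h : cat_hom Z W) (g : cat_hom Y Z)
      (f : cat_hom X Y),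
    cat_comp h (cat_comp g f) = cat_comp (cat_comp h g) f }.

Arguments cat_hom {c}.
Arguments cat_id {c}.
Arguments cat_comp {c X Y Z}.

Record functor (C D : category) := Functor {
  fun_obj :> C -> D;
  fun_hom : forall X Y : C, cat_hom X Y -> cat_hom (fun_obj X) (fun_obj Y);
  fun_hom1 : forall X : C, fun_hom (cat_id X) = cat_id (fun_obj X);
  fun_homM : forall (X Y Z : C) (g : cat_hom Y Z) (f : cat_hom X Y),
    fun_hom (cat_comp g f) = cat_comp (fun_hom g) (fun_hom f) }.

Arguments fun_hom {C D} _ {X Y}.

Section FunctorComp.
Context {C D E : category} (G : functor D E) (F : functor C D).

Let comp_hom (X Y : C) (f : cat_hom X Y) : cat_hom (G (F X)) (G (F Y)) :=
  fun_hom G (fun_hom F f).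

Fact functor_comp_hom1 (X : C) : comp_hom (cat_id X) = cat_id (G (F X)).
Proof. by rewrite /comp_hom !fun_hom1. Qed.

Fact functor_comp_homM (X Y Z : C) (g : cat_hom Y Z) (f : cat_hom X Y) :
  comp_hom (cat_comp g f) = cat_comp (comp_hom g) (comp_hom f).
Proof. by rewrite /comp_hom !fun_homM. Qed.

Definition functor_comp : functor C E :=
  Functor functor_comp_hom1 functor_comp_homM.
End FunctorComp.

Record coalgebra (C : category) (F : functor C C) := Coalgebra {
  coalg_obj : C;
  coalg_map : cat_hom coalg_obj (F coalg_obj) }.

Definition coalgebra_morphism (C : category) (F : functor C C)
    (A B : coalgebra F) (h : cat_hom (coalg_obj A) (coalg_obj B)) : Prop :=
  cat_comp (coalg_map B) h = cat_comp (fun_hom F h) (coalg_map A).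

Definition final_coalgebra (C : category) (F : functor C C)
    (B : coalgebra F) : Prop :=
  forall A : coalgebra F, exists! h, @coalgebra_morphism C F A B h.

Definition SET : category :=
  @Category Type (fun X Y => X -> Y) (fun X x => x)
    (fun X Y Z g f x => g (f x))
    (fun X Y f => erefl) (fun X Y f => erefl)
    (fun X Y Z W h g f => erefl).

Section Pseudometric.
Context {R : realType} (top : \bar R).

Record pseudometric (X : Type) := Pseudometric {
  pm_dist :> X -> X -> \bar R;
  pm_ge0 : forall x y, 0 <= pm_dist x y;
  pm_le_top : forall x y, pm_dist x y <= top;
  pm_refl : forall x, pm_dist x x = 0;
  pm_sym : forall x y, pm_dist x y = pm_dist y x;
  pm_triangle : forall x y z, pm_dist x z <= pm_dist x y + pm_dist y z }.

Lemma pseudometric_eq (X : Type) (d d' : pseudometric X) :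
  (forall x y, d x y = d' x y) -> d = d'.
Proof.
case: d d' => [d a b c e f] [d' a' b' c' e' f'] /= dd'.
have {}dd' : d = d' by apply/funext => x; apply/funext => y.
by subst d'; congr Pseudometric; exact: Prop_irrelevance.
Qed.

Definition nonexpansive (X Y : Type) (dX : pseudometric X)
    (dY : pseudometric Y) (f : X -> Y) : Prop :=
  forall x x', dY (f x) (f x') <= dX x x'.

Record pmspace := PMSpace {
  pm_carrier : Type;
  pm_metric : pseudometric pm_carrier }.

Definition pm_hom (X Y : pmspace) : Type :=
  {f : pm_carrier X -> pm_carrier Y |
    nonexpansive (pm_metric X) (pm_metric Y) f}.

Fact pm_id_subproof (X : pmspace) :
  nonexpansive (pm_metric X) (pm_metric X) (fun x => x).
Proof. by move=> x x'. Qed.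

Definition pm_id (X : pmspace) : pm_hom X X := exist _ _ (@pm_id_subproof X).

Fact pm_comp_subproof (X Y Z : pmspace) (g : pm_hom Y Z) (f : pm_hom X Y) :
  nonexpansive (pm_metric X) (pm_metric Z) (fun x => sval g (sval f x)).
Proof. by move=> x x'; apply: le_trans (svalP g _ _) (svalP f _ _). Qed.

Definition pm_comp (X Y Z : pmspace) (g : pm_hom Y Z) (f : pm_hom X Y) :
  pm_hom X Z := exist _ _ (@pm_comp_subproof X Y Z g f).

Lemma pm_hom_eq (X Y : pmspace) (f g : pm_hom X Y) : sval f = sval g -> f = g.
Proof.
case: f g => [f pf] [g pg] /= fg; subst g.
by congr exist; exact: Prop_irrelevance.
Qed.

Definition PMET : category :=
  @Category pmspace pm_hom pm_id pm_comp
    (fun X Y f => @pm_hom_eq X Y (pm_comp (pm_id Y) f) f erefl)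
    (fun X Y f => @pm_hom_eq X Y (pm_comp f (pm_id X)) f erefl)
    (fun X Y Z W h g f => @pm_hom_eq X W (pm_comp h (pm_comp g f))
                            (pm_comp (pm_comp h g) f) erefl).

Definition forgetful : functor PMET SET :=
  @Functor PMET SET pm_carrier (fun X Y f => sval f)
    (fun X => erefl) (fun X Y Z g f => erefl).

Definition pm_pullback (X Y : Type) (f : X -> Y) (d : pseudometric Y) :
  pseudometric X.
Proof.
exists (fun x x' => d (f x) (f x')) => *.
- exact: pm_ge0.
- exact: pm_le_top.
- exact: pm_refl.
- exact: pm_sym.
- exact: pm_triangle.
Defined.

Definition pm_zero (top_gt0 : 0 < top) (X : Type) : pseudometric X.
Proof.
exists (fun _ _ => 0) => //.
- by move=> _ _; exact: ltW.
- by move=> *; rewrite adde0.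
Defined.

(* [i0] only witnesses that the family is nonempty: the [ereal_sup] of the
   empty set is [-oo]. *)
Definition pm_sup (X I : Type) (i0 : I) (d : I -> pseudometric X) :
  pseudometric X.
Proof.
exists (fun x y => ereal_sup [set d i x y | i in [set: I]]).
- move=> x y; apply: le_trans (pm_ge0 (d i0) x y) _.
  by apply: ereal_sup_ubound; exists i0.
- by move=> x y; apply: ge_ereal_sup => _ [i _ <-]; exact: pm_le_top.
- move=> x; apply/eqP; rewrite eq_le; apply/andP; split.
    by apply: ge_ereal_sup => _ [i _ <-]; rewrite pm_refl.
  by apply: ereal_sup_ubound; exists i0 => //; rewrite pm_refl.
- by move=> x y; congr ereal_sup; apply: eq_imagel => i _; rewrite pm_sym.
- move=> x y z; apply: ge_ereal_sup => _ [i _ <-].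
  by apply: le_trans (pm_triangle (d i) x y z) _; apply: leeD;
    apply: ereal_sup_ubound; exists i.
Defined.

Record lifting (F : functor SET SET) := Lifting {
  lift_functor :> functor PMET PMET;
  lift_strict : functor_comp forgetful lift_functor
                = functor_comp F forgetful }.

Section LiftDist.
Context (F : functor SET SET) (L : lifting F).

Lemma lift_carrier (X : pmspace) : pm_carrier (L X) = F (pm_carrier X).
Proof. exact: (congr1 (fun G : functor PMET SET => G X) (lift_strict L)). Qed.

(* The pseudometric [d^F] on [F X], transported along [lift_carrier]; it is
   characterised by [lift_objE]. *)
Definition lift_dist (X : Type) (d : pseudometric X) : pseudometric (F X) :=
  eq_rect _ pseudometric (pm_metric (L (PMSpace d))) _
    (lift_carrier (PMSpace d)).

Lemma lift_objE (X : Type) (d : pseudometric X) :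
  L (PMSpace d) = PMSpace (lift_dist d).
Proof.
rewrite /lift_dist; move: (lift_carrier _) => /=.
by case: (L (PMSpace d)) => Y dY /= e; case: _ / e.
Qed.

Definition to_lift (Y : pmspace) (X : Type) (d : pseudometric X)
    (k : pm_hom Y (PMSpace (lift_dist d))) : pm_hom Y (L (PMSpace d)) :=
  eq_rect _ (pm_hom Y) k _ (esym (lift_objE d)).

End LiftDist.
End Pseudometric.

Arguments to_lift {R top F} L {Y X d}.

(* An ordinal is represented by a well-ordered type; two isomorphic
   well-ordered types represent the same ordinal. *)
Record Ord := MkOrd {
  ord_sort :> Type;
  ord_rel : ord_sort -> ord_sort -> Prop;
  ord_rel_wf : well_founded ord_rel;
  ord_rel_trans : forall x y z, ord_rel x y -> ord_rel y z -> ord_rel x z;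
  ord_rel_total : forall x y, [\/ ord_rel x y, x = y | ord_rel y x] }.

Definition ord_iso (i j : Ord) : Prop :=
  exists f : i -> j, exists g : j -> i,
    [/\ cancel f g, cancel g f &
        forall x y, ord_rel x y <-> ord_rel (f x) (f y)].

Definition ord_seg (i : Ord) (m : i) : Ord.
Proof.
exists {x : i | ord_rel x m} (fun x y => ord_rel (sval x) (sval y)).
- move=> [x xm]; elim/(well_founded_ind (@ord_rel_wf i)) : x xm => x IH xm.
  by constructor=> -[y ym] /= yx; exact: IH.
- by move=> x y z; exact: ord_rel_trans.
- move=> [x xm] [y ym] /=.
  have [xy|xy|yx] := ord_rel_total x y.
  + exact: Or31.
  + by apply: Or32; subst y; congr exist; exact: Prop_irrelevance.
  + exact: Or33.
Defined.

Definition ord_lt (i j : Ord) : Prop := exists m : j, ord_iso i (ord_seg m).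

Definition succ_rel (i : Ord) (x y : option i) : Prop :=
  match x, y with
  | Some x, Some y => ord_rel x y
  | Some _, None => True
  | None, _ => False
  end.

Lemma succ_rel_wf (i : Ord) : well_founded (@succ_rel i).
Proof.
have accS (x : i) : Acc (@succ_rel i) (Some x).
  elim/(well_founded_ind (@ord_rel_wf i)) : x => x IH.
  by apply: Acc_intro; case=> [y yx|[]]; exact: IH.
by case=> [x|]; [exact: accS|apply: Acc_intro; case=> [y _|[]]; exact: accS].
Qed.

Definition ord_succ (i : Ord) : Ord.
Proof.
exists (option i) (@succ_rel i); first exact: succ_rel_wf.
- by move=> [x|] [y|] [z|] //=; exact: ord_rel_trans.
- move=> [x|] [y|] /=.
  + have [xy|->|yx] := ord_rel_total x y.
    * exact: Or31.
    * exact: Or32.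
    * exact: Or33.
  + exact: Or31.
  + exact: Or33.
  + exact: Or32.
Defined.

Definition ord_greatest (i : Ord) (m : i) : Prop :=
  forall x : i, ~ ord_rel m x.

Definition ord_limit (i : Ord) : Prop :=
  inhabited i /\ ~ exists m : i, ord_greatest m.

Lemma ord_rel_irr (i : Ord) (x : i) : ~ ord_rel x x.
Proof.
elim/(well_founded_ind (@ord_rel_wf i)) : x => x IH xx.
exact: (IH x).
Qed.

Lemma ord_iso_refl (i : Ord) : ord_iso i i.
Proof. by exists id, id. Qed.

Lemma ord_iso_sym (i j : Ord) : ord_iso i j -> ord_iso j i.
Proof.
move=> [f [g [fK gK fM]]]; exists g, f; split=> // x y.
by rewrite fM !gK.
Qed.

Lemma ord_seg_lt (i : Ord) (m : i) : ord_lt (ord_seg m) i.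
Proof. by exists m; exact: ord_iso_refl. Qed.

Lemma ord_lt_wf : well_founded ord_lt.
Proof.
have H (k : Ord) (w : k) (i : Ord) (f : i -> k) :
    (forall x y, ord_rel x y -> ord_rel (f x) (f y)) ->
    (forall x, ord_rel (f x) w) -> Acc ord_lt i.
  elim/(well_founded_ind (@ord_rel_wf k)) : w i f => w IH i f fM fw.
  constructor=> j [m [g [_ [_ _ gM]]]].
  apply: (IH _ (fw m) j (fun x => f (sval (g x)))) => [x y xy|x].
    by apply: fM; exact: (gM x y).1.
  by apply: fM; exact: (svalP (g x)).
move=> i; constructor=> j [m [g [_ [_ _ gM]]]].
apply: (H i m j (fun x => sval (g x))) => [x y xy|x].
  exact: (gM x y).1.
exact: (svalP (g x)).
Qed.

Lemma ord_iso_seg (i j : Ord) (f : i -> j) (g : j -> i) (m : i) :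
  cancel f g -> cancel g f ->
  (forall x y, ord_rel x y <-> ord_rel (f x) (f y)) ->
  ord_iso (ord_seg m) (ord_seg (f m)).
Proof.
move=> fK gK fM.
have gm (y : j) : ord_rel y (f m) -> ord_rel (g y) m by rewrite fM gK.
have fm (x : i) : ord_rel x m -> ord_rel (f x) (f m) by rewrite -fM.
exists (fun u : ord_seg m =>
  exist (fun y => ord_rel y (f m)) (f (sval u)) (fm _ (svalP u))).
exists (fun v : ord_seg (f m) =>
  exist (fun x => ord_rel x m) (g (sval v)) (gm _ (svalP v))).
split=> [[x xm]|[y ym]|x y] /=.
- by apply: eq_exist; exact: fK.
- by apply: eq_exist; exact: gK.
- exact: fM.
Qed.

Section Chain.
Context {R : realType} {top : \bar R} (top_gt0 : 0 < top).
Context {F : functor SET SET} (L : lifting top F).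
Context {Omega : Type} (kappa : Omega -> F Omega).

Definition chain_step (d : pseudometric top Omega) : pseudometric top Omega :=
  pm_pullback kappa (lift_dist L d).

(* A nonempty ordinal is a successor iff it has a greatest element [m], and it
   is then the successor of the initial segment below [m]; the ordinals smaller
   than [i] are, up to isomorphism, its segments [ord_seg x]. *)
Definition chain_body (i : Ord)
    (rec : forall j, ord_lt j i -> pseudometric top Omega) :
    pseudometric top Omega :=
  match pselect (exists x : i, True) with
  | right _ => pm_zero top_gt0 Omega
  | left i_neq0 =>
    match pselect (exists m : i, ord_greatest m) with
    | left i_succ => chain_step (rec _ (ord_seg_lt (sval (cid i_succ))))
    | right _ =>
        pm_sup (sval (cid i_neq0)) (fun x : i => rec _ (ord_seg_lt x))
    end
  end.

Definition chain : Ord -> pseudometric top Omega :=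
  Fix ord_lt_wf (fun _ => pseudometric top Omega) chain_body.

Lemma chainE (i : Ord) :
  chain i = chain_body (fun j (_ : ord_lt j i) => chain j).
Proof.
rewrite /chain Fix_eq // => {}i f g fg; congr chain_body.
by apply: functional_extensionality_dep => j;
  apply: functional_extensionality_dep => ji.
Qed.

Lemma chain_iso (i j : Ord) : ord_iso i j -> chain i = chain j.
Proof.
elim/(well_founded_ind ord_lt_wf) : i j => i IH j [f [g [fK gK fM]]].
rewrite !chainE /chain_body.
case: (pselect (exists x : i, True)) => [i0|ni];
  case: (pselect (exists x : j, True)) => [j0|nj] //; last 2 first.
- by case: nj; case: i0 => x _; exists (f x).
- by case: ni; case: j0 => y _; exists (g y).
have IHf (x : i) : chain (ord_seg x) = chain (ord_seg (f x)).
  by apply: (IH _ (ord_seg_lt x)); exact: ord_iso_seg fM.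
have greatestE (m : i) : ord_greatest m <-> ord_greatest (f m).
  split=> [hm y|hm x].
    by rewrite -[y]gK -fM; exact: hm.
  by rewrite fM; exact: hm.
case: (pselect (exists m : i, ord_greatest m)) => [im|nim];
  case: (pselect (exists m : j, ord_greatest m)) => [jm|njm].
- case: (cid im) => m /= hm; case: (cid jm) => n /= hn.
  rewrite IHf; suff -> : f m = n by [].
  have [fmn|//|nfm] := ord_rel_total (f m) n.
  + by have := (greatestE m).1 hm n.
  + by have := hn (f m).
- by case: njm; case: im => m hm; exists (f m); exact/greatestE.
- case: nim; case: jm => n hn; exists (g n).
  by apply/greatestE; rewrite gK.
- apply: pseudometric_eq => x y /=; congr ereal_sup.
  apply/seteqP; split=> [_ [a _ <-]|_ [b _ <-]].
    by exists (f a) => //; rewrite -IHf.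
  by exists (g b) => //; rewrite IHf gK.
Qed.

Lemma chain0 (i : Ord) : ~ inhabited i -> chain i = pm_zero top_gt0 Omega.
Proof.
move=> i0; rewrite chainE /chain_body.
case: (pselect (exists x : i, True)) => [h|//].
by case: i0; case: h => x _; constructor.
Qed.

Lemma chainS (i : Ord) : chain (ord_succ i) = chain_step (chain i).
Proof.
rewrite chainE /chain_body.
case: (pselect (exists x : ord_succ i, True)) => [h0|h];
  last by case: h; exists None.
have top_greatest : ord_greatest (None : ord_succ i) by move=> x.
case: (pselect (exists m : ord_succ i, ord_greatest m)) => [h|h];
  last by case: h; exists None.
case: (cid h) => -[m|] /= hm; first by case: (hm None).
congr chain_step; apply/chain_iso/ord_iso_sym.
pose g (u : ord_seg (None : ord_succ i)) : i :=
  match u with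
  | exist (Some x) _ => x
  | exist None F => False_rect _ F
  end.
exists (fun x =>
  exist (fun u => @ord_rel (ord_succ i) u None) (Some x) Logic.I).
exists g; split=> //.
by move=> [[x|//] p] /=; apply: eq_exist.
Qed.

Lemma chain_lim (j : Ord) (x y : Omega) : ord_limit j ->
  chain j x y = ereal_sup [set chain i x y | i in [set i | ord_lt i j]].
Proof.
move=> [[j0] nj]; rewrite [in LHS]chainE /chain_body.
case: (pselect (exists x : j, True)) => [h|h]; last by case: h; exists j0.
case: (pselect (exists m : j, ord_greatest m)) => //= nj'; congr ereal_sup.
apply/seteqP; split=> [_ [a _ <-]|_ [i [m im] <-]].
  by exists (ord_seg a) => //; exact: ord_seg_lt.
by exists m => //; rewrite (chain_iso im).
Qed.

End Chain.

(* Main.v *)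
(** The chain [d] is nondecreasing. Indexed by a well-ordering of the power set
    of the set of pseudometrics on [Omega], it cannot be injective (Cantor), so
    it takes the same value at two distinct ordinals, and is stationary from
    the smaller one on. For a coalgebra on [(X, dX)], the unique
    [F]-coalgebra morphism [h : X -> Omega] is nonexpansive for every [d i], by
    induction on [i]: at a successor, lift [h] and use [kappa \o h = F h \o a];
    at a limit, [d i] is a supremum. *)

Require Import Defs.
From mathcomp Require Import all_boot all_order all_algebra.
From mathcomp Require Import boolp classical_sets constructive_ereal reals ereal.
From mathcomp Require wochoice.

Local Open Scope ereal_scope.
Import Order.TTheory.

(** * Cantor's theorem and ordinals on arbitrary types *)

Lemma not_inj_powerset {P : Type} (f : (P -> Prop) -> P) : ~ injective f.
Proof.
(* Cantor's diagonal on the values of [f]: injectivity recovers [A] from [f A], so [f D] would lie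
   in [D] iff it does not. *)
move=> finj; pose D p := exists A, p = f A /\ ~ A p.
have nD : ~ D (f D).
  move=> DfD; have [A [/finj DA nA]] := DfD.
  by apply: nA; rewrite -DA.
by apply: (nD); exists D; split.
Qed.

(* The relation is on [T] rather than on an [eqType]: the sorts of [eqType]s live
   in a larger universe than the sorts of [Ord]s. *)
Lemma exists_well_order (T : Type) : exists r : T -> T -> Prop,
  (forall x y, r x y -> r y x -> x = y) /\
  (forall (A : T -> Prop) x, A x -> exists z, A z /\ forall y, A y -> r z y).
Proof.
have [r wo] := wochoice.well_ordering_principle {classic T}.
have rmin (A : {classic T} -> Prop) x :
    A x -> exists z, A z /\ forall y, A y -> r z y.
  move=> Ax; have [|z [[zA zmin] _]] := wo [pred y | `[< A y >]].
    by exists x; apply/asboolP.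
  exists z; split; first exact/asboolP.
  by move=> y Ay; apply: zmin; apply/asboolP.
exists r; split=> // x y rxy ryx.
have rr z : r z z by have [w [<- wmin]] := rmin (eq z) z erefl; exact: wmin.
(* Both [x] and [y] are least in the pair [{x, y}], and the least element is unique. *)
have [|z [_ zuniq]] := wo (pred2 (x : {classic T}) y).
  by exists x; rewrite !inE eqxx.
transitivity z; [apply/esym|]; apply: zuniq; split;
  rewrite ?inE ?eqxx ?orbT // => u; rewrite !inE; by case/orP => /eqP ->.
Qed.

Section OrdOfWellOrder.
Context {T : Type} {r : T -> T -> Prop}.
Context (well_order_anti : forall x y, r x y -> r y x -> x = y).
Context (well_order_min : forall (A : T -> Prop) x, A x ->
  exists z, A z /\ forall y, A y -> r z y).

Definition strict_part (x y : T) : Prop := r x y /\ x <> y.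

Lemma strict_part_wf : well_founded strict_part.
Proof.
move=> x; apply: contrapT => nx.
have [z [nz zmin]] := well_order_min (fun x => ~ Acc strict_part x) x nx.
apply: nz; constructor=> y [ryz yz]; apply: contrapT => ny.
by apply: yz; apply: well_order_anti => //; exact: zmin.
Qed.

Lemma strict_part_total (x y : T) : [\/ strict_part x y, x = y | strict_part y x].
Proof.
have [<-|xy] := pselect (x = y); first exact: Or32.
have [z [[<-|<-] zmin]] :=
  well_order_min (fun z => x = z \/ y = z) x (or_introl erefl).
  by apply: Or31; split=> //; apply: zmin; right.
by apply: Or33; split; [apply: zmin; left|move=> /esym].
Qed.

Lemma strict_part_trans (x y z : T) :
  strict_part x y -> strict_part y z -> strict_part x z.
Proof.
move=> [rxy xy] [ryz yz].
(* If the least of the three points were [y] or [z], antisymmetry would refute one of the two strict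
   inequalities. *)
have [w [wA wmin]] :=
  well_order_min (fun w => [\/ x = w, y = w | z = w]) x (Or31 _ _ erefl).
case: wA => wE; subst w.
- split; first by apply: wmin; exact: Or33.
  by move=> xz; apply: xy; apply: well_order_anti => //; rewrite xz.
- by case: xy; apply: well_order_anti => //; apply: wmin; exact: Or31.
- by case: yz; apply: well_order_anti => //; apply: wmin; exact: Or32.
Qed.

Definition ord_of_well_order : Ord :=
  @MkOrd T strict_part strict_part_wf strict_part_trans strict_part_total.

End OrdOfWellOrder.

(** Applied to a power set, this gives an ordinal too large for the chain to be injective on its
    segments. *)
Lemma exists_ord_on (T : Type) : exists i : Ord, ord_sort i = T.
Proof.
have [r [ranti rmin]] := exists_well_order T.
by exists (ord_of_well_order ranti rmin).
Qed.

(** By transitivity, whatever lies below [x] already lies below [m]. *)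
Lemma ord_seg_seg {i : Ord} {m x : i} (xm : ord_rel x m) :
  ord_iso (ord_seg (exist _ x xm : ord_seg m)) (ord_seg x).
Proof.
exists (fun u : ord_seg (exist _ x xm : ord_seg m) =>
  exist (fun y => ord_rel y x) (sval (sval u)) (svalP u)).
exists (fun v : ord_seg x =>
  exist (fun y : ord_seg m => ord_rel y (exist _ x xm : ord_seg m))
    (exist (fun y => ord_rel y m) (sval v)
       (ord_rel_trans (svalP v) xm)) (svalP v)).
by split=> [[[y ym] yx]|[y yx]|] //; apply: eq_exist => //; apply: eq_exist.
Qed.

(** * Lifted distances and maps, read on [F X] *)

Section Lift.
Context {R : realType} {top : \bar R} {F : functor SET SET} (L : lifting top F).

(** [lift_carrier] is an equation between types, so points of [L X] must be transported along it to
    be read in [F X]. *)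
Definition lift_cast (X : pmspace top) : pm_carrier (L X) -> F (pm_carrier X) :=
  fun u => eq_rect _ id u _ (lift_carrier L X).

Lemma lift_cast_inj (X : pmspace top) : injective (lift_cast X).
Proof. by rewrite /lift_cast; case: _ / (lift_carrier L X). Qed.

Lemma lift_cast_natural (X Y : PMET top) (f : cat_hom X Y) z :
  lift_cast Y (sval (fun_hom L f) z)
  = fun_hom F (fun_hom (forgetful top) f) (lift_cast X z).
Proof.
(* For an arbitrary equality of functors, [e] can be eliminated; the object equations then become
   loops, trivial by proof irrelevance. *)
suff H (G G' : functor (PMET top) SET) (e : G = G')
    (eX : (G X : Type) = G' X) (eY : (G Y : Type) = G' Y) (u : G X) :
    eq_rect _ id (fun_hom G f u) _ eY = fun_hom G' f (eq_rect _ id u _ eX).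
  exact: (H _ _ (lift_strict L) (lift_carrier L X) (lift_carrier L Y)).
case: _ / e eX eY => eX eY.
by rewrite (Prop_irrelevance eX erefl) (Prop_irrelevance eY erefl).
Qed.

Lemma lift_distE (X : Type) (d : pseudometric top X) z z' :
  lift_dist L d (lift_cast (PMSpace d) z) (lift_cast (PMSpace d) z')
  = pm_metric (L (PMSpace d)) z z'.
Proof.
by rewrite /lift_dist /lift_cast; case: _ / (lift_carrier L (PMSpace d)).
Qed.

Lemma lift_cast_surj (X : pmspace top) u : exists z, lift_cast X z = u.
Proof.
by move: u; rewrite /lift_cast; case: _ / (lift_carrier L X) => u; exists u.
Qed.

Lemma lift_cast_to_lift (Y : pmspace top) (X : Type) (d : pseudometric top X)
    (k : pm_hom Y (PMSpace (lift_dist L d))) y :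
  lift_cast (PMSpace d) (sval (to_lift L k) y) = sval k y.
Proof.
rewrite /to_lift /lift_cast.
(* Generalised together: eliminating the equation of [to_lift] turns the other one into a loop. *)
move: (esym _) (lift_carrier _ _).
case: _ / => e.
by rewrite (Prop_irrelevance e erefl).
Qed.

(** [f] is a morphism of [PMET], so [L f] is nonexpansive, and [lift_cast] identifies it with
    [F f]. *)
Lemma lift_nonexpansive {X Y : Type} {dX : pseudometric top X}
    {dY : pseudometric top Y} {f : X -> Y} :
  nonexpansive dX dY f ->
  nonexpansive (lift_dist L dX) (lift_dist L dY)
    (@fun_hom _ _ F X Y f).
Proof.
move=> fne u u'.
have [z <-] := lift_cast_surj (PMSpace dX) u.
have [z' <-] := lift_cast_surj (PMSpace dX) u'.
pose g : cat_hom (PMSpace dX : PMET top) (PMSpace dY) := exist _ f fne.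
have := svalP (fun_hom L g) z z'.
by rewrite -!lift_distE !lift_cast_natural.
Qed.

(** [d <= d'] says that the identity is nonexpansive from [d'] to [d], and [F] preserves
    identities. *)
Lemma lift_dist_le {X : Type} {d d' : pseudometric top X} :
  (forall x y, d x y <= d' x y) ->
  forall u v, lift_dist L d u v <= lift_dist L d' u v.
Proof.
move=> dd' u v; have := lift_nonexpansive (f := id) dd' u v.
by have /= -> := @fun_hom1 _ _ F X.
Qed.

End Lift.

(** * Monotonicity and stabilisation of the chain *)

Section ChainTheory.
Context {R : realType} {top : \bar R} (top_gt0 : 0 < top).
Context {F : functor SET SET} (L : lifting top F).
Context {Omega : Type} (kappa : Omega -> F Omega).

Local Notation d := (chain top_gt0 L kappa).
Local Notation step := (chain_step L kappa).

(** At a limit the supremum is given by its universal property over the segments of [i], ready for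
    induction on segments. *)
Variant chain_spec (i : Ord) : Prop :=
| ChainZero of ~ inhabited i & d i = pm_zero top_gt0 Omega
| ChainSucc m of @ord_greatest i m & d i = step (d (ord_seg m))
| ChainLim of ord_limit i & (forall (x : i) u v, d (ord_seg x) u v <= d i u v)
    & (forall u v c, (forall x : i, d (ord_seg x) u v <= c) -> d i u v <= c).

Lemma chainP (i : Ord) : chain_spec i.
Proof.
have [i0|i0] := pselect (inhabited i); last by apply: ChainZero; rewrite ?chain0.
have [[m mP]|im] := pselect (exists m : i, ord_greatest m).
  apply: (ChainSucc _ m mP); rewrite chainE /chain_body.
  case: pselect => [h|h]; last by case: h; exists m.
  case: pselect => [h'|h']; last by case: h'; exists m.
  (* By totality, the greatest element chosen in [chain_body] is [m]. *)
  case: (cid h') => n /= nP; have [mn|-> //|nm] := ord_rel_total m n.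
    by case: (mP n).
  by case: (nP m).
have iL : ord_limit i by [].
apply: ChainLim => // [x|] u v.
  rewrite (chain_lim _ _ _ u v iL); apply: ereal_sup_ubound.
  by exists (ord_seg x) => //; exact: ord_seg_lt.
move=> c cP; rewrite (chain_lim _ _ _ u v iL).
by apply: ge_ereal_sup => _ [j [x jx] <-]; rewrite (chain_iso _ _ _ jx).
Qed.

Lemma chain_seg_seg {i : Ord} {m x : i} (xm : ord_rel x m) :
  d (ord_seg x) = d (ord_seg (exist _ x xm : ord_seg m)).
Proof. exact/esym/chain_iso/ord_seg_seg. Qed.

Lemma chain_step_le {e e' : pseudometric top Omega} :
  (forall u v, e u v <= e' u v) -> forall u v, step e u v <= step e' u v.
Proof. by move=> ee' u v; exact: lift_dist_le. Qed.

Lemma chain_nondecreasing (i : Ord) :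
  (forall u v, d i u v <= step (d i) u v) /\
  (forall (x : i) u v, step (d (ord_seg x)) u v <= d i u v).
Proof.
elim/(well_founded_ind ord_lt_wf) : i => i IH.
have {}IH (m : i) := IH _ (ord_seg_lt m).
have [i0 ->|m mP di|[_ im] segle lub] := chainP i.
- split=> [u v|x]; last by case: i0.
  exact: pm_ge0.
- have [m1 m2] := IH m.
  split=> [|x] u v; first by rewrite {1}di; apply: chain_step_le; rewrite di.
  have [xm|->|/mP//] := ord_rel_total x m; last by rewrite di.
  rewrite (chain_seg_seg xm) di; apply: le_trans (m1 u v).
  exact: m2.
- split=> [u v|x u v].
    apply: lub => x; apply: le_trans ((IH x).1 u v) _.
    exact: chain_step_le.
  (* A limit has no greatest element; the second half at [y] then bounds the step at [x]. *)
  have [y xy] : exists y, ord_rel x y.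
    apply: contrapT => nxy; apply: im; exists x => y xy.
    by apply: nxy; exists y.
  apply: le_trans (segle y u v); rewrite (chain_seg_seg xy).
  exact: (IH y).2.
Qed.

Lemma chain_fixpoint : exists theta : Ord, d theta = step (d theta).
Proof.
have [W WE] := exists_ord_on (pseudometric top Omega -> Prop).
have [x [y [xy dxy]]] :
    exists x y : W, ord_rel x y /\ d (ord_seg x) = d (ord_seg y).
  apply: contrapT => H.
  have finj : injective (fun x : W => d (ord_seg x)).
    move=> x y dxy; have [xy|//|yx] := ord_rel_total x y; case: H.
      by exists x, y.
    by exists y, x.
  (* Abstracting the map lets the sort of [W] be rewritten to the power set. *)
  move: (fun x : W => _) finj; rewrite WE => f.
  exact: not_inj_powerset.
(* [step (d (ord_seg x))] is at most [d (ord_seg y)], which equals [d (ord_seg x)]. *)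
exists (ord_seg x); apply: pseudometric_eq => u v.
apply/eqP; rewrite eq_le (chain_nondecreasing _).1 /= {2}dxy.
by rewrite (chain_seg_seg xy); exact: (chain_nondecreasing _).2.
Qed.

Lemma chain_nonexpansive {X : Type} {dX : pseudometric top X} {a : X -> F X}
    {h : X -> Omega} (i : Ord) :
  nonexpansive dX (lift_dist L dX) a ->
  (forall x, kappa (h x) = @fun_hom _ _ F X Omega h (a x)) ->
  nonexpansive dX (d i) h.
Proof.
move=> ane hP; elim/(well_founded_ind ord_lt_wf) : i => i IH x x'.
have [_ ->|m _ ->|_ _] := chainP i.
- exact: pm_ge0.
- rewrite /= !hP; apply: le_trans (ane x x').
  exact: (lift_nonexpansive L (IH _ (ord_seg_lt m))).
- by apply=> y; exact: (IH _ (ord_seg_lt y)).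
Qed.

End ChainTheory.

(** * Finality of [kappa] at the fixed point *)

Theorem theorem28 (R : realType) (top : \bar R) (top_gt0 : 0 < top)
    (F : functor SET SET) (L : lifting top F)
    (Omega : Type) (kappa : Omega -> F Omega)
    (kappa_final : final_coalgebra (@Coalgebra SET F Omega kappa)) :
  let d := chain top_gt0 L kappa in
  exists theta : Ord,
    (forall x y, d theta x y = lift_dist L (d theta) (kappa x) (kappa y)) /\
    exists k : pm_hom (PMSpace (d theta)) (PMSpace (lift_dist L (d theta))),
      (forall x, sval k x = kappa x) /\
      final_coalgebra
        (@Coalgebra (PMET top) L (PMSpace (d theta)) (to_lift L k)).
Proof.
move=> d; have [theta dfix] := chain_fixpoint top_gt0 L kappa.
have dE x y : d theta x y = lift_dist L (d theta) (kappa x) (kappa y).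
  by rewrite {1}/d dfix.
exists theta; split=> //.
have kne : nonexpansive (d theta) (lift_dist L (d theta)) kappa.
  by move=> x y; rewrite -dE.
pose k : pm_hom (PMSpace (d theta)) (PMSpace (lift_dist L (d theta))) :=
  exist _ kappa kne.
exists k; split=> // -[[X dX] a].
pose b (x : X) : F X := lift_cast L (PMSpace dX) (sval a x).
have bne : nonexpansive dX (lift_dist L dX) b.
  by move=> x x'; rewrite lift_distE; exact: (svalP a).
(* Since [lift_cast] is natural and injective, the coalgebra equations in [PMET] and in [SET] are
   equivalent, so uniqueness is inherited from [SET]. *)
have morE (h : pm_hom (PMSpace dX) (PMSpace (d theta))) :
    @coalgebra_morphism (PMET top) L (@Coalgebra (PMET top) L (PMSpace dX) a)
      (@Coalgebra (PMET top) L (PMSpace (d theta)) (to_lift L k)) h <->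
    @coalgebra_morphism SET F (@Coalgebra SET F X b)
      (@Coalgebra SET F Omega kappa) (sval h).
  have compE x :
      lift_cast L (PMSpace (d theta)) (sval (fun_hom L h) (sval a x))
      = @fun_hom _ _ F X Omega (sval h) (b x).
    exact: lift_cast_natural.
  split=> [/(congr1 sval)/= E|E].
    apply/funext => x /=; rewrite -compE.
    apply: etrans (esym (lift_cast_to_lift L _ _ _ k (sval h x))) _.
    by congr (lift_cast L _ _); exact: (congr1 (@^~ x) E).
  apply: pm_hom_eq; apply/funext => x /=.
  apply: (lift_cast_inj L (PMSpace (d theta))).
  apply: etrans (lift_cast_to_lift L _ _ _ k (sval h x)) _.
  by rewrite compE; exact: (congr1 (@^~ x) E).
have [h [hmor huniq]] := kappa_final (@Coalgebra SET F X b).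
(* Existence only requires the [SET] morphism to be nonexpansive. *)
have hne : nonexpansive dX (d theta) h.
  apply: (chain_nonexpansive _ _ _ _ bne) => x.
  exact: (congr1 (@^~ x) hmor).
exists (exist _ h hne); split; first exact/morE.
by move=> g /morE/huniq hg; apply: pm_hom_eq.
Qed.
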